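(* Consider a triangular array (as described in the context, with $m(n)=\lfloor n^\alpha\rfloor$, $\alpha>1$) with predictors of the form $g_\beta(X_1,\ldots,X_m)=\rho(\sum_j\beta_jX_j)$, so that the loss can be written $l(\beta,Z)=h(Y,\sum_j\beta_jX_j)$. Assume that $h(y,t)$ is bounded and is uniformly continuous in $t$, both uniformly in $y$. Assume that the variables $X_j$ are bounded by a common finite constant under all $F_n\in\mathcal{F}_n$, for all $n$ and all $j\le m(n)$. Let $k_n$ be positive integers with $k_n=o(n/\log n)$, and suppose that $\beta^*_{F_n}$ has at most $k_n$ nonzero entries for all $F_n\in\mathcal{F}_n$ and all $n$. Suppose further that there is a constant $R>0$ such that $\|\beta^*_{F_n}\|_2\le R$ for all $F_n\in\mathcal{F}_n$, $n=1,2,\ldots$. Then the following procedure is persistent with respect to $B^n$: select the predictor $$\tilde\beta=\arg\min_{\beta}L_{\hat F_n}(\beta)\quad\text{subject to}\quad\|\beta\|_1\le R\sqrt{k_n}.$$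
   Context: Triangular array: for each $n$ there is a dimension $m=m(n)=\lfloor n^{\alpha}\rfloor$ for a fixed $\alpha>1$; a collection $\mathcal{F}_n$ of distributions of a random vector $Z=(Y,X_1,\ldots,X_m)$; predictors $g_\beta(X_1,\ldots,X_m)=\rho(\sum_j\beta_jX_j)$, $\beta\in\mathbb{R}^m$, with $\rho$ a fixed real function; a set $B^n\subset\mathbb{R}^{m}$ of parameters; and a nonnegative prediction loss $l$, with $l(\beta,Z)$ denoting $l(Y,g_\beta(X_1,\ldots,X_m))$. The functions $\rho$, $l$ and hence $h(y,t)=l(y,\rho(t))$ do not depend on $n$. At stage $n$ one observes i.i.d. vectors $Z^1,\ldots,Z^n$ with distribution $F_n$, where $F_n\in\mathcal{F}_n$ is unknown. Risk: $L_F(\beta)=E_F\,l(\beta,Z)$. Empirical risk: $L_{\hat F_n}(\beta)=\frac1n\sum_{i=1}^n l(\beta,Z^i)$, where $\hat F_n$ is the empirical distribution of $Z^1,\ldots,Z^n$. The best predictor is $\beta^*_{F_n}=\arg\min_{\beta\in B^n}L_{F_n}(\beta)$ (assumed to exist; if it is not unique, a condition imposed on it is understood to hold for one of the minimizers). A sequence of procedures $\tilde\beta_n=\tilde\beta_n(Z^1,\ldots,Z^n)$ is persistent with respect to $B^n$ if for every $\varepsilon>0$, $\sup_{F_n\in\mathcal{F}_n}P_{F_n}(L_{F_n}(\tilde\beta_n)-L_{F_n}(\beta^*_{F_n})>\varepsilon)\to0$ as $n\to\infty$, where $P_{F_n}$ is the probability when $Z^1,\ldots,Z^n$ are i.i.d.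 $F_n$. *)

(* Defs.v *)
From HB Require Import structures.
From mathcomp Require Import all_boot all_order all_algebra.
From mathcomp Require Import all_classical all_reals all_analysis.
Set Implicit Arguments.
Unset Strict Implicit.
Unset Printing Implicit Defensive.
Import Order.TTheory GRing.Theory Num.Theory.
Import numFieldNormedType.Exports.
Local Open Scope classical_set_scope.
Local Open Scope ring_scope.

Definition is_argmin {d : Order.disp_t} {V : porderType d} {T : Type}
    (f : T -> V) (S : set T) (x : T) : Prop :=
  S x /\ forall y, S y -> (f x <= f y)%O.

Section iid_law.
Context {R : realType} {d : measure_display} {T : measurableType d}.

Definition cons_tuple (n : nat) (z : T * n.-tuple T) : n.+1.-tuple T :=
  [tuple of z.1 :: z.2].

Lemma measurable_cons_tuple (n : nat) : measurable_fun setT (@cons_tuple n).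
Proof. exact: measurable_cons. Qed.

HB.instance Definition _ (n : nat) :=
  isMeasurableFun.Build _ _ _ _ (@cons_tuple n) (@measurable_cons_tuple n).

Variable F : probability T R.

(* The n-fold product F \x ... \x F, i.e. the law of (Z^1, ..., Z^n) for
   Z^1, ..., Z^n i.i.d. with distribution F; see [iid_lawE]. *)
Fixpoint iid_law (n : nat) : probability (n.-tuple T) R :=
  match n with
  | 0%N => \d_([tuple] : 0.-tuple T)
  | k.+1 => distribution (F \x iid_law k)%E (@cons_tuple k)
  end.

Lemma iid_lawE (n : nat) (A : 'I_n -> set T) :
  (forall i, measurable (A i)) ->
  (iid_law n [set z | forall i, A i (tnth z i)] =
   \big[*%E/1]_(i < n) F (A i))%E.
Proof.
elim: n A => [|n IH] A mA.
  by rewrite big_ord0 /= diracE mem_set// => -[].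
rewrite big_ord_recl -IH; last by move=> i; exact: mA.
rewrite -(product_measure1E F (iid_law n)) //; first last.
- rewrite (_ : [set z | _] = \bigcap_(i in [set: 'I_n])
      ((@tnth n T ^~ i) @^-1` A (lift ord0 i))).
    apply: fin_bigcap_measurable => [|i _]; first exact: finite_finset.
    by rewrite -[X in measurable X]setTI; exact: measurable_tnth.
  by apply/seteqP; split=> z /= h i; [move=> _|]; exact: h.
rewrite [LHS]/= /distribution /pushforward.
apply: (congr1 (F \x iid_law n)%E); apply/seteqP; split => -[x z] /=.
  move=> h; split; first by have := h ord0.
  by move=> i; have := h (lift ord0 i); rewrite /cons_tuple tnthS.
move=> [h0 h] i; case: (unliftP ord0 i) => [j|] -> //.
by rewrite /cons_tuple tnthS; exact: h.
Qed.

End iid_law.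

(* The values of Z = (Y, X_1, ..., X_m), with the Borel sigma-algebra. *)
Notation obs R m := (R * m.-tuple R)%type.

Section linear_prediction.
Variable R : realType.

Definition array_dim (alpha : R) (n : nat) : nat := Num.truncn (n%:R `^ alpha).

Definition nnz (m : nat) (b : 'rV[R]_m) : nat := #|[pred j | b 0 j != 0]|.

Definition norm1 (m : nat) (b : 'rV[R]_m) : R := \sum_(j < m) `|b 0 j|.

Definition norm2 (m : nat) (b : 'rV[R]_m) : R :=
  Num.sqrt (\sum_(j < m) b 0 j ^+ 2).

Variables (l : R -> R -> R) (rho : R -> R).

Definition predictor (m : nat) (b : 'rV[R]_m) (x : m.-tuple R) : R :=
  rho (\sum_(j < m) b 0 j * tnth x j).

Definition loss (m : nat) (b : 'rV[R]_m) (z : obs R m) : R :=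
  l z.1 (predictor b z.2).

Definition risk (m : nat) (F : probability (obs R m) R) (b : 'rV[R]_m) : \bar R :=
  ('E_F[loss b])%E.

Definition empirical_risk (m n : nat) (z : n.-tuple (obs R m)) (b : 'rV[R]_m) : R :=
  n%:R^-1 * \sum_(i < n) loss b (tnth z i).

(* [persistent FF B bt]: the procedure bt is persistent with respect to B, for
   the classes FF n of distributions.  Stages are n >= 1.  The excess risk does
   not depend on the choice of the minimizers bs.  The procedure is not required
   to be measurable: probabilities are outer probabilities (mu_ext), which agree
   with the probability on measurable events.  The added 0 makes the supremum
   over an empty class 0 rather than -oo. *)
Definition persistent (m : nat -> nat)
    (FF : forall n, set (probability (obs R (m n)) R))
    (B : forall n, set 'rV[R]_(m n))
    (bt : forall n, n.-tuple (obs R (m n)) -> 'rV[R]_(m n)) : Prop :=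
  exists2 bs : forall n, probability (obs R (m n)) R -> 'rV[R]_(m n),
    forall n F, (0 < n)%N -> FF n F -> is_argmin (risk F) (B n) (bs n F) &
    forall eps : R, 0 < eps ->
      (fun n => ereal_sup ([set 0%E] `|`
         [set mu_ext (iid_law F n)
                [set z | (eps%:E < risk F (bt n z) - risk F (bs n F))%E]
         | F in FF n])) @ \oo --> 0%E.

End linear_prediction.

(* Main.v *)
Require Import Defs.
From HB Require Import structures.
From mathcomp Require Import all_boot all_order all_algebra.
From mathcomp Require Import all_classical all_reals all_analysis.
From mathcomp Require Import measurable_realfun ring lra.
Set Implicit Arguments.
Unset Strict Implicit.
Unset Printing Implicit Defensive.
Import Order.TTheory GRing.Theory Num.Theory.
Import numFieldNormedType.Exports.
Local Open Scope classical_set_scope.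
Local Open Scope ring_scope.

(** Empirical risk minimization over an l1 ball is persistent as soon as, with
    probability tending to 1 uniformly over the class of distributions, the
    empirical risk is uniformly close to the risk on that ball: the minimizer
    over B n has l1 norm at most r sqrt k by the Cauchy-Schwarz inequality
    ([norm1_le]), hence is a competitor of the procedure, whose excess risk is
    therefore at most twice the uniform deviation.

    Uniform closeness is obtained without empirical process theory. Maurey's
    argument ([maurey]) replaces a parameter b of the l1 ball of radius b0 by
    the average of N independent random points with mean b, each of them one
    of the 2m vertices of the ball or its centre. For covariates bounded by C,
    the linear predictor then changes by at most (b0 C)^2 / N in mean square.
    As the loss is bounded and uniformly continuous in the linear predictor,
    it changes by at most eps + D s^2 when the latter changes by s
    ([quadratic_modulus]); so the mean over the draw of the loss at the random
    average is close to the loss at b, for all bounded observations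
    simultaneously. Both the risk and the empirical risk inherit this, whence
    it suffices to control their difference at these (2m+1)^N averages
    ([uniform_deviation]). With b0^2 = r^2 k, the error is small for N = K k
    with a constant K.

    At finitely many parameters, Chernoff bounds added up over the parameters
    ([finite_class_deviation]) give an exceptional probability of at most
    2 (2m+1)^(K k) exp(- c n). This tends to 0 ([deviation_bound_cvg0]) because
    ln m = O(ln n) and k = o(n / ln n), and it does not depend on the
    distribution. *)

(** * Moment generating functions of bounded variables *)

(** Reciprocal of 1 - x <= expR (- x), using (1 - x) (1 + x + 2 x^2) >= 1 for
    x <= 1/2; it turns a bound on a moment generating function into a bound
    on a second moment. *)
Lemma expR_le_quadratic (R : realType) (x : R) : x <= 2^-1 ->
  expR x <= 1 + x + 2 * x ^+ 2.
Proof.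
move=> hx.
have h1 : 1 - x <= expR (- x) by exact: expR_ge1Dx.
have h0 : 0 < 1 - x by lra.
have h2 : expR x * expR (- x) = 1 by rewrite -expRD subrr expR0.
have h3 : expR x * (1 - x) <= 1.
  by rewrite -[leRHS]h2 ler_pM2l// expR_gt0.
rewrite -(ler_pM2r h0); apply: (le_trans h3).
have : 0 <= x ^+ 2 * (1 - 2 * x) by rewrite mulr_ge0 ?sqr_ge0//; lra.
nra.
Qed.

Section bounded_mean.
Context {R : realType} {d : measure_display} {T : measurableType d}.
Variable P : probability T R.
Variables (f : T -> R) (M : R).
Hypotheses (mf : measurable_fun [set: T] f) (fM : forall x, `|f x| <= M).

Lemma bounded_integrable : P.-integrable [set: T] (EFin \o f).
Proof.
apply: measurable_bounded_integrable => //.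
  by rewrite -ge0_fin_numE// fin_num_measure.
exists M; split; first exact: num_real.
by move=> x Mx y _; exact: le_trans (fM y) (ltW Mx).
Qed.

Lemma mean_cst (c : R) : \int[P]_x c = c.
Proof.
rewrite Rintegral_cst//; set p := fine _.
rewrite (_ : p = 1) ?mulr1// /p (_ : _ [set: T] = 1%E)//.
exact: probability_setT.
Qed.

Lemma normr_mean_le : `|\int[P]_x f x| <= M.
Proof.
have icst (c : R) : P.-integrable [set: T] (EFin \o cst c).
  exact: finite_measure_integrable_cst.
rewrite ler_norml -{1}(mean_cst (- M)) -{2}(mean_cst M); apply/andP; split.
all:
  apply: le_Rintegral => //; try exact: icst; try exact: bounded_integrable.
  all: by move=> x _; have := fM x; rewrite ler_norml => /andP[].
Qed.

(** A weak form of Hoeffding's lemma, sufficient for an exponential rate: in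
    the quadratic upper bound of the exponential, the linear term has mean 0
    and the square is at most (2 M)^2. *)
Lemma centered_mgf_le (s : R) : `|s| * (4 * M) <= 1 ->
  (\int[P]_x (expR (s * (f x - \int[P]_y f y)))%:E
     <= (expR (8 * s ^+ 2 * M ^+ 2))%:E)%E.
Proof.
move=> hs; set mu := Rintegral _ _ _.
have muM : `|mu| <= M by exact: normr_mean_le.
have M0 : 0 <= M by exact: le_trans muM.
(* The square is bounded by a constant at once, so that only an affine
   function of f remains to be integrated. *)
pose c := 1 + 8 * s ^+ 2 * M ^+ 2 - s * mu.
have fmu x : `|f x - mu| <= 2 * M.
  by rewrite (le_trans (ler_normB _ _))// mulr_natl mulr2n lerD.
have pt x : expR (s * (f x - mu)) <= c + s * f x.
  have small : `|s * (f x - mu)| <= 2^-1.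
    rewrite normrM (le_trans (ler_wpM2l (normr_ge0 s) (fmu x)))//; lra.
  apply: (le_trans (expR_le_quadratic (le_trans (ler_norm _) small))).
  have : (f x - mu) ^+ 2 <= (2 * M) ^+ 2.
    by rewrite -[leLHS]real_normK ?num_real// lerXn2r ?nnegrE// mulr_ge0.
  move=> /(ler_wpM2l (sqr_ge0 s)); rewrite /c; nra.
have icst (e : R) : P.-integrable [set: T] (EFin \o cst e).
  exact: finite_measure_integrable_cst.
have isf : P.-integrable [set: T] (EFin \o (fun x => s * f x)).
  by have := integrableZl measurableT s bounded_integrable.
have ilin : P.-integrable [set: T] (EFin \o (fun x => c + s * f x)).
  by have := integrableD measurableT (icst c) isf.
have le_affine : (\int[P]_x (expR (s * (f x - mu)))%:E
    <= \int[P]_x (c + s * f x)%:E)%E.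
  apply: ge0_le_integral => //.
  - apply/measurable_EFinP; apply: (measurableT_comp (@measurable_expR R)).
    by apply: measurable_funM => //; exact: measurable_funB.
  - exact: (measurable_int P ilin).
  - by move=> x _; rewrite lee_fin; exact: pt.
apply: (le_trans le_affine).
rewrite -[leLHS]fineK; last by apply: integrable_fin_num => //; exact: ilin.
rewrite lee_fin -/(Rintegral P setT (fun x => c + s * f x)).
rewrite [leLHS](RintegralD measurableT (icst c) isf) mean_cst.
rewrite (RintegralZl s measurableT bounded_integrable).
rewrite -/mu /c.
apply: le_trans (expR_ge1Dx _); lra.
Qed.

End bounded_mean.

(** * Product laws and exponential deviations of a finite class *)

Section iid_product.
Context {R : realType} {d : measure_display} {T : measurableType d}.
Variable F : probability T R.

(** Independence of the observations, by induction: Tonelli's theorem splits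
    off the first one. *)
Lemma integral_iid_law_prod_le (g : T -> R) (a : R) n :
  measurable_fun [set: T] g -> (forall x, 0 <= g x) ->
  (\int[F]_x (g x)%:E <= a%:E)%E ->
  (\int[iid_law F n]_z (\prod_(i < n) g (tnth z i))%:E <= (a ^+ n)%:E)%E.
Proof.
move=> mg g0 ga.
have a0 : 0 <= a.
  by rewrite -lee_fin (le_trans _ ga)// integral_ge0// => x _; rewrite lee_fin.
have mprod k : measurable_fun [set: k.-tuple T]
    (fun z => (\prod_(i < k) g (tnth z i))%:E).
  apply/measurable_EFinP; apply: measurable_prod => i _.
  by apply: measurableT_comp => //; exact: measurable_tnth.
have prod0 k (z : k.-tuple T) : (0 <= (\prod_(i < k) g (tnth z i))%:E)%E.
  by rewrite lee_fin prodr_ge0.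
elim: n => [|n IH].
  under eq_integral do rewrite big_ord0.
  rewrite integral_cst// (_ : _ [set: _] = 1%E) ?mule1 ?expr0//.
  exact: (@probability_setT _ _ _ (iid_law F 0)).
rewrite /= ge0_integral_distribution; [|exact: mprod|exact: prod0].
have -> : (fun z : n.+1.-tuple T => (\prod_(i < n.+1) g (tnth z i))%:E)
      \o @Defs.cons_tuple _ T n =
    (fun z => (g z.1)%:E * (\prod_(i < n) g (tnth z.2 i))%:E)%E.
  apply/funext => z /=; rewrite big_ord_recl -EFinM; congr (_ * _)%:E.
  by apply: eq_bigr => i _; rewrite /Defs.cons_tuple tnthS.
have mfun : measurable_fun [set: T * n.-tuple T]
   (fun z => ((g z.1)%:E * (\prod_(i < n) g (tnth z.2 i))%:E)%E).
  apply: emeasurable_funM.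
    by apply/measurable_EFinP; exact: measurableT_comp.
  exact: (measurableT_comp (mprod n)).
rewrite fubini_tonelli1//; last by move=> z; rewrite mule_ge0// lee_fin.
have inner : (\int[F]_x fubini_F (iid_law F n) (fun z : T * n.-tuple T =>
      (g z.1)%:E * (\prod_(i < n) g (tnth z.2 i))%:E) x
    <= \int[F]_x ((a ^+ n)%:E * (g x)%:E))%E.
  apply: ge0_le_integral => //.
  - by move=> x _; apply: integral_ge0 => z _; rewrite mule_ge0// lee_fin.
  - by apply: measurable_fun_fubini_tonelli_F => // z; rewrite mule_ge0// lee_fin.
  - by apply: measurable_funeM; exact/measurable_EFinP.
  - move=> x _; rewrite /fubini_F /= ge0_integralZl//;
      [|exact: mprod|by move=> z _; exact: prod0|by rewrite lee_fin].
    by rewrite muleC lee_wpmul2r// lee_fin.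
apply: (le_trans inner).
rewrite ge0_integralZl//.
- by rewrite exprSr EFinM lee_wpmul2l// lee_fin exprn_ge0.
- exact/measurable_EFinP.
- by move=> x _; rewrite lee_fin.
- by rewrite lee_fin exprn_ge0.
Qed.

Lemma measurable_exists_tnth n (A : set T) : measurable A ->
  measurable [set z : n.-tuple T | exists i, A (tnth z i)].
Proof.
move=> mA.
rewrite (_ : [set z | _] =
    \bigcup_(i in [set: 'I_n]) ((@tnth n T ^~ i) @^-1` A)).
  apply: fin_bigcup_measurable => [|i _]; first exact: finite_finset.
  by rewrite -[X in measurable X]setTI; exact: measurable_tnth.
by apply/seteqP; split => z /= [i]; [exists i|move=> _; exists i].
Qed.

Lemma iid_law_null n (A : set T) : measurable A -> F A = 0%E ->
  iid_law F n [set z | exists i, A (tnth z i)] = 0%E.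
Proof.
move=> mA FA; set E := [set z | _].
have mE : measurable E by exact: measurable_exists_tnth.
have E1 : iid_law F n (~` E) = 1%E.
  rewrite (_ : ~` E = [set z | forall i, (~` A) (tnth z i)]); last first.
    by apply/seteqP; split => z /= /forallNP.
  rewrite (@iid_lawE _ _ _ _ _ (fun=> ~` A)); last by move=> i; exact: measurableC.
  by rewrite big1// => i _; rewrite probability_setC// FA sube0.
rewrite -[E]setCK probability_setC; last exact: measurableC.
by rewrite E1 subee.
Qed.

End iid_product.

Section deviation.
Context {R : realType} {d : measure_display} {T : measurableType d}.
Variable F : probability T R.

(** Chernoff's method for all functions and both signs at once: the
    exponential moments are added up over the class, and Markov's inequality is
    applied once to the sum W, which reaches 1 as soon as one of the empirical
    means deviates by more than tau. *)
Lemma finite_class_deviation (I : finType) (f : I -> T -> R) (M tau : R) n :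
  (forall i, measurable_fun [set: T] (f i)) -> (forall i x, `|f i x| <= M) ->
  0 < tau -> tau <= M -> (0 < n)%N ->
  exists A : set (n.-tuple T), [/\ measurable A,
    (iid_law F n A <= (2 * #|I|%:R *
       expR (- (n%:R * (tau ^+ 2 / (32 * M ^+ 2)))))%:E)%E &
    forall z, ~ A z -> forall i,
      `|n%:R^-1 * (\sum_(j < n) f i (tnth z j)) - \int[F]_x f i x| <= tau].
Proof.
move=> mf fM tau0 tauM n0.
have M0 : 0 < M by exact: lt_le_trans tauM.
(* This s minimizes the exponent 8 s^2 M^2 - s tau of one observation; the
   minimum is - c. *)
pose s := tau / (16 * M ^+ 2).
have s0 : 0 < s by rewrite divr_gt0// mulr_gt0// exprn_gt0.
pose c := tau ^+ 2 / (32 * M ^+ 2).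
have sgE (b : bool) : ((-1) ^+ b * s) ^+ 2 = s ^+ 2.
  by rewrite exprMn sqrr_sign mul1r.
have sM : s * (4 * M) <= 1.
  have -> : s * (4 * M) = tau / M / 4 by rewrite /s; field; rewrite gt_eqF.
  have : tau / M <= 1 by rewrite ler_pdivrMr// mul1r.
  lra.
pose mu i := \int[F]_x f i x.
pose g (p : I * bool) x :=
  expR ((-1) ^+ p.2 * s * (f p.1 x - mu p.1) - s * tau).
have g0 p x : 0 <= g p x by exact: expR_ge0.
have mg p : measurable_fun [set: T] (g p).
  apply: (measurableT_comp (@measurable_expR R)).
  apply: measurable_funB => //; apply: measurable_funM => //.
  exact: measurable_funB.
have ga p : (\int[F]_x (g p x)%:E <= (expR (- c))%:E)%E.
  have -> : (\int[F]_x (g p x)%:E = (expR (- (s * tau)))%:E *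
     \int[F]_x (expR ((-1) ^+ p.2 * s * (f p.1 x - mu p.1)))%:E)%E.
    have mexp : measurable_fun [set: T]
        (fun x => (expR ((-1) ^+ p.2 * s * (f p.1 x - mu p.1)))%:E).
      apply/measurable_EFinP; apply: (measurableT_comp (@measurable_expR R)).
      by apply: measurable_funM => //; exact: measurable_funB.
    rewrite -ge0_integralZl//.
    by apply: eq_integral => x _; rewrite /g -EFinM -expRD addrC.
  have := @centered_mgf_le _ _ _ F _ M (mf p.1) (fM p.1) ((-1) ^+ p.2 * s).
  rewrite normrM normr_sign mul1r gtr0_norm// sgE => /(_ sM) h.
  apply: (@le_trans _ _ ((expR (- (s * tau)))%:E *
      (expR (8 * s ^+ 2 * M ^+ 2))%:E)%E).
    by rewrite lee_wpmul2l// lee_fin expR_ge0.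
  rewrite -EFinM lee_fin -expRD ler_expR /s /c.
  by rewrite le_eqVlt; apply/orP; left; apply/eqP; field; rewrite gt_eqF.
pose W (z : n.-tuple T) := \sum_(p : I * bool) \prod_(j < n) g p (tnth z j).
have mprod p : measurable_fun [set: n.-tuple T]
    (fun z : n.-tuple T => \prod_(j < n) g p (tnth z j)).
  apply: measurable_prod => j _.
  by apply: measurableT_comp => //; exact: measurable_tnth.
have mW : measurable_fun [set: n.-tuple T] W by apply: measurable_sum.
have W0 z : 0 <= W z by apply: sumr_ge0 => p _; exact: prodr_ge0.
have intW : (\int[iid_law F n]_z (W z)%:E
    <= (2 * #|I|%:R * expR (- (n%:R * c)))%:E)%E.
  under eq_integral do rewrite -sumEFin.
  rewrite ge0_integral_sum//; last 2 first.
  - by move=> p; exact/measurable_EFinP.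
  - by move=> p z _; rewrite lee_fin prodr_ge0.
  apply: (@le_trans _ _ (\sum_(p : I * bool) (expR (- c) ^+ n)%:E)%E).
    by apply: lee_sum => p _; exact: integral_iid_law_prod_le.
  rewrite sumEFin lee_fin sumr_const card_prod card_bool -[leLHS]mulr_natl natrM.
  by rewrite -expRM_natl mulrN [#|I|%:R * 2]mulrC.
pose A := [set z : n.-tuple T | 1 <= W z].
have mA : measurable A.
  rewrite (_ : A = W @^-1` `[1, +oo[%classic).
    by rewrite -[X in measurable X]setTI; exact: mW.
  by apply/seteqP; split => z /=; rewrite /A /= in_itv/= andbT.
exists A; split => //.
  apply: le_trans intW.
  have := @le_integral_comp_abse _ _ _ (iid_law F n) _ measurableT
    (EFin \o W) 1 id.
  move=> /(_ (@measurable_id _ _ _) (fun _ => id) (fun _ _ _ _ => id)) h.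
  have {h} := h (proj2 (measurable_EFinP _ _) mW) ltr01.
  rewrite mul1e setTI.
  rewrite (_ : [set x | _] = A); last first.
    by apply/seteqP; split => x /=; rewrite /A /= lee_fin ger0_norm.
  by under eq_integral do rewrite /= ger0_norm//.
move=> z nAz i.
have Wlt1 : W z < 1 by rewrite ltNge; exact/negP.
set S := \sum_(j < n) _.
have side (b : bool) : (-1) ^+ b * (S - n%:R * mu i) <= n%:R * tau.
  rewrite leNgt; apply/negP => hlt.
  suff : 1 <= W z by rewrite leNgt Wlt1.
  rewrite /W (bigD1 (i, b))//=.
  apply: (@le_trans _ _ (\prod_(j < n) g (i, b) (tnth z j))); last first.
    by rewrite lerDl sumr_ge0// => p _; exact: prodr_ge0.
  rewrite /g -expR_sum -[leLHS]expR0 ler_expR big_split/= -mulr_sumr.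
  rewrite sumrN sumr_const card_ord -mulr_natl sumrB sumr_const.
  rewrite card_ord -/S -[mu i *+ n]mulr_natl.
  have -> : (-1) ^+ b * s * (S - n%:R * mu i) - n%:R * (s * tau) =
    s * ((-1) ^+ b * (S - n%:R * mu i) - n%:R * tau) by ring.
  by apply: mulr_ge0; [exact: ltW|rewrite subr_ge0 ltW].
have n0' : 0 < n%:R :> R by rewrite ltr0n.
rewrite -/(mu i) ler_norml -(ler_pM2l n0') -[X in _ && X](ler_pM2l n0').
rewrite mulrBr mulrA mulfV ?gt_eqF// mul1r.
have := side true; have := side false; rewrite expr0 expr1; lra.
Qed.
End deviation.

(** * Maurey's empirical method *)

Section product_weights.
Context {R : realType} {S : finType}.
Variables (w : S -> R) (N : nat).
Hypotheses (w0 : forall s, 0 <= w s) (w1 : \sum_s w s = 1).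

Definition prod_weight (phi : {ffun 'I_N -> S}) : R := \prod_(i < N) w (phi i).

Lemma sum_prod_weight : \sum_phi prod_weight phi = 1.
Proof.
rewrite -(bigA_distr_bigA (fun (i : 'I_N) s => w s)).
by rewrite big1// => i _.
Qed.

(** Off-diagonal pairs are uncorrelated for centred c: the sum over phi
    factors into a product of sums, and the factors i and j then vanish. *)
Lemma prod_weight_pair (c : S -> R) (i j : 'I_N) : \sum_s w s * c s = 0 ->
  \sum_phi prod_weight phi * (c (phi i) * c (phi j)) =
  if j == i then \sum_s w s * c s ^+ 2 else 0.
Proof.
move=> wc0.
pose G (k : 'I_N) s :=
  w s * ((if k == i then c s else 1) * (if k == j then c s else 1)).
transitivity (\sum_(phi : {ffun 'I_N -> S}) \prod_k G k (phi k)).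
  apply: eq_bigr => phi _; rewrite !big_split/=.
  by rewrite -!big_mkcond !big_pred1_eq.
rewrite -(bigA_distr_bigA G) (bigD1 i)//=.
have [eij|nij] := eqVneq j i.
  rewrite [X in _ * X]big1 ?mulr1.
    by apply: eq_bigr => s _; rewrite /G eij eqxx expr2.
  move=> k /negPf ki; rewrite -[RHS]w1; apply: eq_bigr => s _.
  by rewrite /G eij ki !mulr1.
rewrite [X in X * _](_ : _ = 0) ?mul0r// -[RHS]wc0; apply: eq_bigr => s _.
by rewrite /G eqxx eq_sym (negPf nij) mulr1.
Qed.

(** The square of the centred mean of the draws expands into pairs of draws,
    of which only the N diagonal ones contribute. *)
Lemma prod_weight_variance (a : S -> R) (A : R) : (0 < N)%N ->
  (forall s, `|a s| <= A) ->
  \sum_phi prod_weight phi *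
    (N%:R^-1 * (\sum_(i < N) a (phi i)) - \sum_s w s * a s) ^+ 2 <= A ^+ 2 / N%:R.
Proof.
move=> N0 aA; set mu := \sum_s w s * a s.
pose c s := a s - mu.
have wc0 : \sum_s w s * c s = 0.
  under eq_bigr do rewrite mulrBr.
  by rewrite sumrB -mulr_suml w1 mul1r subrr.
have wc2 : \sum_s w s * c s ^+ 2 <= A ^+ 2.
  have -> : \sum_s w s * c s ^+ 2 = \sum_s w s * a s ^+ 2 - mu ^+ 2.
    transitivity (\sum_s (w s * a s ^+ 2 - 2 * mu * (w s * a s) + mu ^+ 2 * w s)).
      by apply: eq_bigr => s _; rewrite /c; ring.
    rewrite big_split sumrB/= -!mulr_sumr w1 -/mu; ring.
  apply: (@le_trans _ _ (\sum_s w s * a s ^+ 2)); first by rewrite gerBl sqr_ge0.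
  rewrite -[leRHS]mul1r -w1 mulr_suml; apply: ler_sum => s _.
  rewrite ler_wpM2l// -[leLHS]real_normK ?num_real//.
  by rewrite lerXn2r ?nnegrE// (le_trans _ (aA s)).
have NR : 0 < N%:R :> R by rewrite ltr0n.
have -> : \sum_phi prod_weight phi *
      (N%:R^-1 * (\sum_(i < N) a (phi i)) - mu) ^+ 2 =
    N%:R^-2 * \sum_(i < N) \sum_(j < N) \sum_phi
      prod_weight phi * (c (phi i) * c (phi j)).
  under [in RHS]eq_bigr do rewrite exchange_big/=.
  rewrite exchange_big/= mulr_sumr; apply: eq_bigr => phi _.
  under [in RHS]eq_bigr do rewrite -mulr_sumr -mulr_sumr.
  rewrite -mulr_sumr -mulr_suml.
  have -> : \sum_(i < N) c (phi i) = \sum_(i < N) a (phi i) - N%:R * mu.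
    by rewrite sumrB sumr_const card_ord mulr_natl.
  by field; rewrite gt_eqF.
under eq_bigr => i _.
  under eq_bigr do rewrite prod_weight_pair//.
  rewrite -big_mkcond big_pred1_eq.
  over.
rewrite sumr_const card_ord; set V := \sum_s _ in wc2 *.
rewrite -[V *+ N]mulr_natl (_ : N%:R^-2 * _ = V / N%:R).
  by rewrite ler_pM2r// invr_gt0.
by field; rewrite gt_eqF.
Qed.
End product_weights.

Section maurey.
Context {R : realType} {m : nat}.

Definition dot (b : 'rV[R]_m) (x : m.-tuple R) : R :=
  \sum_(j < m) b 0 j * tnth x j.

(** The 2m vertices of the l1 ball of radius b0, together with its centre: the
    centre takes up the weight left by parameters of norm less than b0. *)
Definition l1_vertex (b0 : R) (s : 'I_m * bool + unit) : 'rV[R]_m :=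
  match s with inl (j, e) => ((-1) ^+ e * b0) *: delta_mx 0 j | inr _ => 0 end.

Definition vertex_average (b0 : R) (N : nat)
  (phi : {ffun 'I_N -> 'I_m * bool + unit}) : 'rV[R]_m :=
  N%:R^-1 *: \sum_(i < N) l1_vertex b0 (phi i).

Lemma dot_vertex_average b0 N phi x : dot (@vertex_average b0 N phi) x =
  N%:R^-1 * \sum_(i < N) dot (l1_vertex b0 (phi i)) x.
Proof.
rewrite /dot exchange_big/= mulr_sumr; apply: eq_bigr => j _.
by rewrite mxE summxE -mulrA mulr_suml.
Qed.

Lemma dot_l1_vertex b0 j e x :
  dot (l1_vertex b0 (inl (j, e))) x = (-1) ^+ e * b0 * tnth x j.
Proof.
rewrite /dot (bigD1 j)//= big1 ?addr0.
  by rewrite !mxE !eqxx mulr1.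
by move=> k kj; rewrite !mxE (negPf kj) andbF mulr0 mul0r.
Qed.

Lemma dot_l1_vertex0 b0 u x : dot (l1_vertex b0 (inr u)) x = 0.
Proof. by rewrite /dot big1// => j _; rewrite mxE mul0r. Qed.

(** Maurey's empirical method. A point b of the l1 ball is a convex combination
    of the vertices and the centre; N independent draws with these weights have
    an average whose scalar product with x has mean dot b x and a variance of
    order 1/N, whatever the dimension. The weights w do not depend on x, so
    the same mixture serves the risk and the empirical risk. *)
Lemma maurey (b0 C : R) (N : nat) (b : 'rV[R]_m) :
  0 < b0 -> 0 <= C -> (0 < N)%N -> norm1 b <= b0 ->
  exists w : {ffun 'I_N -> 'I_m * bool + unit} -> R,
    [/\ forall phi, 0 <= w phi, \sum_phi w phi = 1 &
      forall x : m.-tuple R, (forall j, `|tnth x j| <= C) ->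
        \sum_phi w phi * (dot (vertex_average b0 phi) x - dot b x) ^+ 2
          <= (b0 * C) ^+ 2 / N%:R].
Proof.
move=> b00 C0 N0 hb.
pose w (s : 'I_m * bool + unit) : R := match s with
  | inl (j, e) => if (b 0 j < 0) == e then `|b 0 j| / b0 else 0
  | inr _ => 1 - norm1 b / b0 end.
have sumE (f : 'I_m * bool + unit -> R) :
    \sum_s f s =
    (\sum_(j < m) (f (inl (j, true)) + f (inl (j, false)))) + f (inr tt).
  rewrite big_sumType/=; congr (_ + _).
    rewrite (eq_bigr (fun p => f (inl (p.1, p.2)))); last by case.
    rewrite -(pair_bigA _ (fun j e => f (inl (j, e))))/=.
    by apply: eq_bigr => j _; rewrite big_bool.
  by rewrite (bigD1 tt)//= big1 ?addr0// => -[].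
have w0 s : 0 <= w s.
  case: s => [[j e]|_] /=; last by rewrite subr_ge0 ler_pdivrMr// mul1r.
  by case: ifP => // _; rewrite divr_ge0// ltW.
have w1 : \sum_s w s = 1.
  rewrite sumE /= addrC; set v := \sum_(j < m) _.
  rewrite (_ : v = norm1 b / b0) ?subrK// /v /norm1 mulr_suml.
  by apply: eq_bigr => j _; case: (b 0 j < 0); rewrite ?addr0 ?add0r.
exists (@prod_weight R _ w N); split.
- by move=> phi; exact: prodr_ge0.
- exact: sum_prod_weight.
move=> x xC.
have wa : \sum_s w s * dot (l1_vertex b0 s) x = dot b x.
  rewrite sumE dot_l1_vertex0 mulr0 addr0; apply: eq_bigr => j _.
  rewrite !dot_l1_vertex /= [b 0 j in RHS]realEsign ?num_real//.
  by case: (b 0 j < 0) => /=; field; rewrite gt_eqF.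
rewrite -wa; under eq_bigr do rewrite dot_vertex_average.
apply: prod_weight_variance => // -[[j e]|u].
  by rewrite dot_l1_vertex !normrM normr_sign mul1r gtr0_norm// ler_pM2l.
by rewrite dot_l1_vertex0 normr0 mulr_ge0// ltW.
Qed.
End maurey.

(** * Measurability and linearity of integrals *)

(** A function measurable in y and continuous in t is the pointwise limit of
    the functions obtained by rounding t down to a multiple of 1/n.+1, which
    are measurable since they have countably many pieces in t. *)
Lemma measurable_caratheodory (R : realType) (d : measure_display)
    (T : measurableType d) (h : T -> R -> R) :
  (forall t, measurable_fun [set: T] (h ^~ t)) -> (forall y, continuous (h y)) ->
  measurable_fun [set: T * R] (fun z => h z.1 z.2).
Proof.
move=> mh ch.
pose q (n : nat) (t : R) : R := (Num.floor (n.+1%:R * t))%:~R / n.+1%:R.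
apply: (@measurable_fun_cvg _ _ _ _ (fun n z => h z.1 (q n z.2))) => [n|[y t] _ /=].
  move=> _ Y mY; rewrite setTI.
  rewrite (_ : _ @^-1` Y = \bigcup_(i : int)
      (fst @^-1` ((h ^~ (i%:~R / n.+1%:R)) @^-1` Y) `&`
       snd @^-1` [set t | i%:~R <= n.+1%:R * t < (i + 1)%:~R])).
    apply: countable_bigcupT_measurable => // i; apply: measurableI.
      rewrite -[X in measurable X]setTI; apply: measurable_fst => //.
      by rewrite -[X in measurable X]setTI; exact: mh.
    rewrite -[X in measurable X]setTI; apply: measurable_snd => //.
    rewrite (_ : [set t | _] =
        ( *%R n.+1%:R) @^-1` `[i%:~R, (i + 1)%:~R[%classic).
      by rewrite -[X in measurable X]setTI; exact: mulrl_measurable.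
    by apply/seteqP; split => t /=; rewrite in_itv.
  apply/seteqP; split => -[y t] /=.
    move=> Yh; exists (Num.floor (n.+1%:R * t)) => //.
    by split => //=; exact: floor_itv.
  by move=> [i _ [/= Yh /floor_def fl]]; rewrite /q fl.
have qt : q n t @[n --> \oo] --> t.
  apply: (@squeeze_cvgr _ _ _ _ (fun n => t - n.+1%:R^-1) (fun=> t)).
  - near=> n; have n0 : 0 < n.+1%:R :> R by rewrite ltr0n.
    rewrite /q ler_pdivlMr// ler_pdivrMr// mulrBl mulVf ?gt_eqF// ![t * _]mulrC.
    rewrite floor_le andbT lerBlDr ltW// (lt_le_trans (floorD1_gt _))//.
    by rewrite intrD.
  - rewrite -[X in _ --> X]subr0; apply: cvgB; first exact: cvg_cst.
    exact: cvg_harmonic.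
  - exact: cvg_cst.
exact: (cvg_comp _ _ qt (ch y t)).
Unshelve. all: by end_near. Qed.

Lemma Rintegral_lincomb (R : realType) (d : measure_display)
    (T : measurableType d) (P : probability T R) (I : finType) (w : I -> R)
    (f : I -> T -> R) :
  (forall i, P.-integrable [set: T] (EFin \o f i)) ->
  P.-integrable [set: T] (EFin \o (fun x => \sum_i w i * f i x)) /\
  \int[P]_x (\sum_i w i * f i x) = \sum_i w i * \int[P]_x f i x.
Proof.
move=> intf; elim: (index_enum I) => [|i s [IH1 IH2]].
  split; last first.
    rewrite big_nil (@eq_Rintegral _ _ _ _ _ (cst 0)) ?Rintegral_cst ?mul0r//.
    by move=> x _; rewrite big_nil.
  rewrite (_ : EFin \o _ = cst 0%E); last by apply/funext => x /=; rewrite big_nil.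
  exact: integrable0.
have iw : P.-integrable [set: T] (EFin \o (fun x => w i * f i x)).
  by have := integrableZl measurableT (w i) (intf i).
split.
  have := integrableD measurableT iw IH1; congr (_.-integrable _ _).
  by apply/funext => x; rewrite /= big_cons EFinD.
under eq_Rintegral do rewrite big_cons.
by rewrite [LHS]RintegralD// RintegralZl// IH2 big_cons.
Qed.

(** * Uniform deviation of the empirical risk on an l1 ball *)

Section loss.
Context {R : realType} (l : R -> R -> R) (rho : R -> R) (M : R).
Hypothesis hlmeas : forall t, measurable_fun [set: R] (fun y => l y (rho t)).
Hypothesis hbounded : forall y t, `|l y (rho t)| <= M.
Hypothesis hunif : forall eps : R, 0 < eps -> exists2 delta : R, 0 < delta &
     forall y s t, `|s - t| < delta -> `|l y (rho s) - l y (rho t)| < eps.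

(** Where s and t are delta-close, uniform continuity gives eps; elsewhere
    the bound 2 M is at most 2 M (s - t)^2 / delta^2. This form of the modulus
    of continuity is the one that can be averaged against a variance. *)
Lemma quadratic_modulus (eps : R) : 0 < eps ->
  exists2 D : R, 0 <= D &
    forall y s t, `|l y (rho s) - l y (rho t)| <= eps + D * (s - t) ^+ 2.
Proof.
move=> eps0; have [delta delta0 hd] := hunif eps0.
have M0 : 0 <= M by exact: le_trans (hbounded 0 0).
have D0 : 0 <= 2 * M / delta ^+ 2.
  by apply: divr_ge0; [exact: mulr_ge0|exact: sqr_ge0].
exists (2 * M / delta ^+ 2) => //.
move=> y s t; have [st|st] := ltP `|s - t| delta.
  by rewrite (le_trans (ltW (hd y s t st)))// lerDl mulr_ge0// sqr_ge0.
apply: (@le_trans _ _ (2 * M)).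
  by rewrite (le_trans (ler_normB _ _))// mulr_natl mulr2n lerD.
rewrite -[leLHS]add0r lerD ?(ltW eps0)//.
have d2 : 0 < delta ^+ 2 by rewrite exprn_gt0.
rewrite -mulrA ler_peMr ?mulr_ge0// ler_pdivlMl// mulr1.
by rewrite -[leRHS]real_normK ?num_real// lerXn2r ?nnegrE// ltW.
Qed.

Context {m : nat}.
Implicit Types (F : probability (obs R m) R) (b : 'rV[R]_m) (z : obs R m).

Lemma measurable_loss b : measurable_fun [set: obs R m] (loss l rho b).
Proof.
have mh : measurable_fun [set: R * R] (fun u => l u.1 (rho u.2)).
  apply: (@measurable_caratheodory _ _ _ (fun y t => l y (rho t))) => // y t.
  apply/cvgrPdist_lt => eps eps0; have [delta delta0 hd] := hunif eps0.
  near=> s; apply: hd; near: s.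
  by have /cvgrPdist_lt := @cvg_id _ (nbhs t); exact.
have mdot : measurable_fun [set: obs R m] (fun z => (z.1, dot b z.2)).
  apply: measurable_fun_pair => //; apply: measurable_sum => j.
  apply: measurable_funM => //.
  by apply: (measurableT_comp (measurable_tnth j)).
exact: (measurableT_comp mh mdot).
Unshelve. all: by end_near. Qed.

Definition mean_loss (F : probability (obs R m) R) b : R := \int[F]_z loss l rho b z.

Lemma integrable_loss F b : F.-integrable [set: obs R m] (EFin \o loss l rho b).
Proof.
exact: (bounded_integrable F (measurable_loss b) (fun z => hbounded z.1 _)).
Qed.

Lemma riskE F b : risk l rho F b = (mean_loss F b)%:E.
Proof.
rewrite /risk unlock /mean_loss /Rintegral fineK//.
by apply: integrable_fin_num => //; exact: integrable_loss.
Qed.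

Section mixture.
Variables (I : finType) (w : I -> R) (v : I -> 'rV[R]_m) (b : 'rV[R]_m).
Hypotheses (w0 : forall i, 0 <= w i) (w1 : \sum_i w i = 1).

Lemma mixture_loss_le (eps D V : R) z : 0 <= D ->
  (forall y s t, `|l y (rho s) - l y (rho t)| <= eps + D * (s - t) ^+ 2) ->
  \sum_i w i * (dot (v i) z.2 - dot b z.2) ^+ 2 <= V ->
  `|\sum_i w i * loss l rho (v i) z - loss l rho b z| <= eps + D * V.
Proof.
move=> D0 hD hV.
have -> : \sum_i w i * loss l rho (v i) z - loss l rho b z =
    \sum_i w i * (loss l rho (v i) z - loss l rho b z).
  under [RHS]eq_bigr do rewrite mulrBr.
  by rewrite sumrB -mulr_suml w1 mul1r.
apply: (le_trans (ler_norm_sum _ _ _)).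
apply: (@le_trans _ _ (\sum_i w i * (eps + D * (dot (v i) z.2 - dot b z.2) ^+ 2))).
  by apply: ler_sum => i _; rewrite normrM ger0_norm// ler_wpM2l//; exact: hD.
under eq_bigr do rewrite mulrDr mulrCA.
by rewrite big_split/= -mulr_suml w1 mul1r -mulr_sumr lerD2l ler_wpM2l.
Qed.

Lemma mixture_mean_le F (eta : R) : 0 <= eta ->
  {ae F, forall z, `|\sum_i w i * loss l rho (v i) z - loss l rho b z| <= eta} ->
  `|\sum_i w i * mean_loss F (v i) - mean_loss F b| <= eta.
Proof.
move=> eta0 hae.
have [intS intE] :=
  @Rintegral_lincomb _ _ _ F _ w _ (fun i => integrable_loss F (v i)).
have intD := integrableB measurableT intS (integrable_loss F b).
rewrite /mean_loss -intE -RintegralB//; last exact: integrable_loss.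
set g := fun z => _ : R.
have ig : F.-integrable [set: obs R m] (EFin \o g) by exact: intD.
rewrite -lee_fin EFin_normr_Rintegral//.
apply: (le_trans (le_abse_integral _ _ (measurable_int _ ig))) => //.
have := @integral_le_bound _ _ _ F [set: obs R m] (EFin \o g) eta%:E
  measurableT (measurable_int _ ig).
rewrite lee_fin (_ : _ [set: obs R m] = 1%E) ?mule1; last exact: probability_setT.
apply => //; apply: filterS hae => z hz _.
by rewrite lee_fin.
Qed.

Lemma mixture_empirical_le n (z : n.-tuple (obs R m)) (eta : R) : (0 < n)%N ->
  (forall i, `|\sum_k w k * loss l rho (v k) (tnth z i)
               - loss l rho b (tnth z i)| <= eta) ->
  `|\sum_k w k * empirical_risk l rho z (v k)
    - empirical_risk l rho z b| <= eta.
Proof.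
move=> n0 h; have n0' : 0 < n%:R :> R by rewrite ltr0n.
have -> : \sum_k w k * empirical_risk l rho z (v k) - empirical_risk l rho z b =
  n%:R^-1 * \sum_(i < n) (\sum_k w k * loss l rho (v k) (tnth z i)
                           - loss l rho b (tnth z i)).
  rewrite sumrB mulrBr; congr (_ - _).
  rewrite exchange_big/= mulr_sumr; apply: eq_bigr => k _.
  by rewrite -mulr_sumr mulrCA.
rewrite normrM gtr0_norm ?invr_gt0// ler_pdivrMl//.
apply: (le_trans (ler_norm_sum _ _ _)).
apply: (@le_trans _ _ (\sum_(i < n) eta)); first exact: ler_sum.
by rewrite sumr_const card_ord mulr_natl.
Qed.
End mixture.

(** Uniform law of large numbers on the l1 ball of radius b0. The exceptional
    set only controls the finitely many averages of N vertices and the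
    boundedness of the sampled covariates. Any b in the ball is then compared
    with its mixture of such averages, once under F and once under the sample,
    at a cost eps + D (b0 C)^2 / N each time. *)
Lemma uniform_deviation (F : probability (obs R m) R) (n N : nat)
    (C b0 tau eps D : R) :
  (0 < n)%N -> (0 < N)%N -> 0 <= C -> 0 < b0 -> 0 < tau -> tau <= M -> 0 <= D ->
  (forall y s t, `|l y (rho s) - l y (rho t)| <= eps + D * (s - t) ^+ 2) ->
  {ae F, forall z : obs R m, forall j, `|tnth z.2 j| <= C} ->
  exists A : set (n.-tuple (obs R m)), [/\ measurable A,
    (iid_law F n A <= (2 * ((m * 2 + 1) ^ N)%:R *
       expR (- (n%:R * (tau ^+ 2 / (32 * M ^+ 2)))))%:E)%E &
    forall z : n.-tuple (obs R m), ~ A z -> forall b, norm1 b <= b0 ->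
      `|empirical_risk l rho z b - mean_loss F b|
        <= tau + 2 * (eps + D * ((b0 * C) ^+ 2 / N%:R))].
Proof.
move=> n0 N0 C0 b00 tau0 tauM D0 hD hX.
pose v phi := @vertex_average R m b0 N phi.
have [A1 [mA1 PA1 hA1]] := @finite_class_deviation _ _ _ F _
  (fun phi => loss l rho (v phi)) M tau n (fun phi => measurable_loss (v phi))
  (fun _ _ => hbounded _ _) tau0 tauM n0.
have [A0 [mA0 FA0 hA0]] := hX.
have mA2 : measurable [set z : n.-tuple (obs R m) | exists i, A0 (tnth z i)].
  exact: measurable_exists_tnth.
exists (A1 `|` [set z | exists i, A0 (tnth z i)]); split.
- exact: measurableU.
- rewrite (@measureU0 _ _ _ (iid_law F n))//; last exact: iid_law_null.
  apply: (le_trans PA1).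
  rewrite lee_fin card_ffun card_ord card_sum card_prod card_ord card_bool.
  by rewrite card_unit.
move=> z /not_orP[nA1 nA2] b hb.
have [w [w0 w1 wV]] := maurey b00 C0 N0 hb.
pose eta := eps + D * ((b0 * C) ^+ 2 / N%:R).
have eta0 : 0 <= eta.
  have eps0 : 0 <= eps.
    by have := hD 0 0 0; rewrite !subrr normr0 expr0n mulr0 addr0.
  by rewrite addr_ge0// mulr_ge0// divr_ge0// sqr_ge0.
have mix z' : (forall j, `|tnth z'.2 j| <= C) ->
    `|\sum_phi w phi * loss l rho (v phi) z' - loss l rho b z'| <= eta.
  by move=> hz; apply: mixture_loss_le => //; exact: wV.
have mixF : `|\sum_phi w phi * mean_loss F (v phi) - mean_loss F b| <= eta.
  by apply: mixture_mean_le => //; apply: filterS hX => z'; exact: mix.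
have mixn : `|\sum_phi w phi * empirical_risk l rho z (v phi)
    - empirical_risk l rho z b| <= eta.
  apply: mixture_empirical_le => // i; apply: mix.
  apply: contrapT => h; apply: nA2; exists i; exact: hA0.
have dev : `|\sum_phi w phi * empirical_risk l rho z (v phi)
    - \sum_phi w phi * mean_loss F (v phi)| <= tau.
  rewrite -sumrB; under eq_bigr do rewrite -mulrBr.
  apply: (le_trans (ler_norm_sum _ _ _)).
  rewrite -[leRHS]mul1r -w1 mulr_suml; apply: ler_sum => phi _.
  by rewrite normrM ger0_norm// ler_wpM2l//; exact: hA1.
move: mixF mixn dev; rewrite -/eta !ler_norml => /andP[? ?] /andP[? ?] /andP[? ?].
apply/andP; split; lra.
Qed.

End loss.

(** * Norms and asymptotics *)

(** The Cauchy-Schwarz inequality on the support of b, in the form of the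
    inequality between arithmetic and geometric means for each entry. *)
Lemma norm1_le (R : realType) (m k : nat) (r : R) (b : 'rV[R]_m) :
  (0 < k)%N -> 0 < r -> (nnz b <= k)%N -> norm2 b <= r ->
  norm1 b <= r * Num.sqrt k%:R.
Proof.
move=> k0 r0 bk br; pose q : R := Num.sqrt k%:R; rewrite -/q.
have kR : 0 < k%:R :> R by rewrite ltr0n.
have q0 : 0 < q by rewrite sqrtr_gt0.
have qq : q ^+ 2 = k%:R by rewrite sqr_sqrtr// ltW.
have S : \sum_(j < m) b 0 j ^+ 2 <= r ^+ 2.
  have s0 : 0 <= \sum_(j < m) b 0 j ^+ 2.
    by apply: sumr_ge0 => j _; exact: sqr_ge0.
  by rewrite -[leLHS]sqr_sqrtr// lerXn2r ?nnegrE ?sqrtr_ge0// ltW.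
have pt j : `|b 0 j| <=
    r / (2 * q) * (b 0 j != 0)%:R + q / (2 * r) * b 0 j ^+ 2.
  have [->|b0] := eqVneq (b 0 j) 0; first by rewrite normr0 expr0n !mulr0 addr0.
  rewrite mulr1 -(real_normK (num_real (b 0 j))); set t := `|_|.
  rewrite -subr_ge0.
  have -> : r / (2 * q) + q / (2 * r) * t ^+ 2 - t =
      (q * t - r) ^+ 2 / (2 * q * r).
    by field; rewrite !gt_eqF.
  by rewrite divr_ge0 ?sqr_ge0// !mulr_ge0// ltW.
apply: (@le_trans _ _ (\sum_(j < m)
    (r / (2 * q) * (b 0 j != 0)%:R + q / (2 * r) * b 0 j ^+ 2))).
  by apply: ler_sum => j _; exact: pt.
rewrite big_split/= -!mulr_sumr -natr_sum.
have -> : (\sum_(j < m) (b 0%R j != 0%R) = nnz b)%N.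
  rewrite /nnz -sum1_card [RHS]big_mkcond/=; apply: eq_bigr => j _.
  by rewrite inE; case: eqP.
have -> : r * q = r / (2 * q) * q ^+ 2 + q / (2 * r) * r ^+ 2.
  by field; rewrite !gt_eqF.
have rq : 0 < r / (2 * q) by rewrite divr_gt0// mulr_gt0.
have qr : 0 < q / (2 * r) by rewrite divr_gt0// mulr_gt0.
by rewrite qq; apply: lerD; rewrite ler_pM2l// ler_nat.
Qed.

(** The logarithm of the number of averages of K k vertices is at most of
    order K k ln n, as the dimension is polynomial in n; since k = o(n / ln n) this
    is eventually below c n / 2, half of the exponent in the deviation bound. *)
Lemma deviation_bound_cvg0 (R : realType) (alpha c : R) (k : nat -> nat) (K : nat) :
  0 <= alpha -> 0 < c ->
  (fun n => (k n)%:R : R) =o_\oo (fun n => n%:R / ln n%:R : R) ->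
  2 * ((array_dim alpha n * 2 + 1) ^ (K * k n))%:R * expR (- (n%:R * c))
    @[n --> \oo] --> (0 : R).
Proof.
move=> alpha0 c0 /eqoP hk.
(* g is such that k <= g n / ln n makes the log-cardinality at most c n / 2;
   the summand 1 keeps the denominator positive when K = 0. *)
pose g : R := c / (2 * (K%:R * (alpha + 2) + 1)).
have g0 : 0 < g.
  by rewrite divr_gt0// mulr_gt0// ltr_wpDl// mulr_ge0// addr_ge0.
have hgeo : 2 * expR (- (c / 2)) ^+ n @[n --> \oo] --> (0 : R).
  rewrite -[X in _ --> X](mulr0 2); apply: cvgM; first exact: cvg_cst.
  apply: cvg_expr; rewrite ger0_norm ?expR_ge0// -expR0 ltr_expR oppr_lt0.
  by rewrite divr_gt0.
apply: (@squeeze_cvgr _ _ _ _ (fun=> 0) _ _ _ _ _ hgeo); last exact: cvg_cst.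
near=> n; apply/andP; split.
  by rewrite !mulr_ge0// expR_ge0.
have n2 : (1 < n)%N by near: n; exact: nbhs_infty_gt.
have nR : 0 < n%:R :> R by rewrite ltr0n; exact: ltnW.
have lnn : 0 < ln n%:R :> R by rewrite ln_gt0// ltr1n.
have hkn : (k n)%:R * ln n%:R <= g * n%:R :> R.
  have : `|(k n)%:R : R| <= g * `|n%:R / ln n%:R : R|.
    by near: n; exact: hk.
  rewrite normr_nat ger0_norm; last by apply: divr_ge0 => //; exact: ltW.
  by rewrite mulrA ler_pdivlMr.
have dim : (array_dim alpha n * 2 + 1)%:R <= expR ((alpha + 2) * ln n%:R) :> R.
  have h1 : 1 <= n%:R `^ alpha :> R.
    by rewrite /powR gt_eqF// -[leLHS]expR0 ler_expR mulr_ge0// ltW.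
  have h2 : (array_dim alpha n)%:R <= n%:R `^ alpha :> R.
    by rewrite /array_dim Num.Theory.truncn_le// powR_ge0.
  apply: (@le_trans _ _ (n%:R ^+ 2 * n%:R `^ alpha)).
    rewrite natrD natrM.
    (* 2 m + 1 <= 3 n^alpha, and 3 <= n^2 as n >= 2 *)
    apply: (@le_trans _ _ (3 * n%:R `^ alpha)); first lra.
    rewrite ler_wpM2r ?powR_ge0//.
    by rewrite -natrX ler_nat; apply: (@leq_trans (2 ^ 2)) => //; rewrite leq_exp2r.
  by rewrite mulrDl expRD mulrC /powR gt_eqF// expRM_natl lnK// posrE.
have pow : ((array_dim alpha n * 2 + 1) ^ (K * k n))%:R
    <= expR (n%:R * (c / 2)) :> R.
  rewrite natrX.
  apply: (@le_trans _ _ (expR ((alpha + 2) * ln n%:R) ^+ (K * k n))).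
    by rewrite lerXn2r ?nnegrE ?expR_ge0.
  rewrite -expRM_natl ler_expR natrM.
  have -> : K%:R * (k n)%:R * ((alpha + 2) * ln n%:R) =
    K%:R * (alpha + 2) * ((k n)%:R * ln n%:R) by ring.
  apply: (@le_trans _ _ (K%:R * (alpha + 2) * (g * n%:R))).
    by rewrite ler_wpM2l// mulr_ge0// addr_ge0.
  have -> : n%:R * (c / 2) = (K%:R * (alpha + 2) + 1) * (g * n%:R).
    by rewrite /g; field; rewrite gt_eqF// ltr_wpDl// mulr_ge0// addr_ge0.
  by rewrite [leRHS]mulrDl mul1r lerDl mulr_ge0// ltW.
rewrite -mulrA ler_pM2l// -expRM_natl.
have -> : n%:R * - (c / 2) = n%:R * (c / 2) + - (n%:R * c) by field.
by rewrite expRD ler_wpM2r// expR_ge0.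
Unshelve. all: by end_near. Qed.

(** * Persistence *)

Theorem theorem2 (R : realType) (alpha : R) (halpha : 1 < alpha)
  (l : R -> R -> R) (rho : R -> R)
  (hl0 : forall y p, 0 <= l y p)
  (hlmeas : forall t, measurable_fun [set: R] (fun y => l y (rho t)))
  (hbounded : exists M : R, forall y t, `|l y (rho t)| <= M)
  (hunif : forall eps : R, 0 < eps -> exists2 delta : R, 0 < delta &
     forall y s t, `|s - t| < delta -> `|l y (rho s) - l y (rho t)| < eps)
  (FF : forall n, set (probability (obs R (array_dim alpha n)) R))
  (B : forall n, set 'rV[R]_(array_dim alpha n))
  (C : R)
  (hX : forall n F, (0 < n)%N -> FF n F ->
     {ae F, forall z, forall j, `|tnth z.2 j| <= C})
  (k : nat -> nat)
  (hk0 : forall n, (0 < n)%N -> (0 < k n)%N)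
  (hk : (fun n => (k n)%:R : R) =o_\oo (fun n => n%:R / ln n%:R : R))
  (r : R) (hr : 0 < r)
  (hbest : forall n F, (0 < n)%N -> FF n F ->
     exists bstar : 'rV[R]_(array_dim alpha n),
       [/\ is_argmin (risk l rho F) (B n) bstar,
           (nnz bstar <= k n)%N & norm2 bstar <= r])
  (btilde : forall n, n.-tuple (obs R (array_dim alpha n)) -> 'rV[R]_(array_dim alpha n))
  (hbtilde : forall n z, (0 < n)%N ->
     is_argmin (empirical_risk l rho z)
       [set b | norm1 b <= r * Num.sqrt (k n)%:R] (btilde n z)) :
  persistent l rho FF B btilde.

Proof.
pose P n F := [set b : 'rV[R]_(array_dim alpha n) |
  [/\ is_argmin (risk l rho F) (B n) b, (nnz b <= k n)%N & norm2 b <= r]].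
pose bs n F := xget 0 (P n F).
have bsP n F : (0 < n)%N -> FF n F -> P n F (bs n F).
  by move=> n0 FnF; apply: xgetPex; exact: hbest.
exists bs; first by move=> n F n0 FnF; have [] := bsP n F n0 FnF.
move=> eps eps0.
have [M0 hM0] := hbounded.
(* The bound M is enlarged so that M >= tau and M > 0. *)
pose M : R := `|M0| + 1 + eps.
have hM y t : `|l y (rho t)| <= M.
  rewrite (le_trans (hM0 y t))// (le_trans (ler_norm M0))// /M.
  by rewrite -addrA lerDl addr_ge0// ltW.
(* Error budget: the excess risk is at most twice the uniform deviation, which
   is tau + 2 (eps / 16 + eps / 16) = eps / 2. *)
pose tau : R := eps / 4.
have tau0 : 0 < tau by rewrite divr_gt0.
have tauM : tau <= M by have := normr_ge0 M0; rewrite /tau /M; lra.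
have [D D0 hD] := quadratic_modulus hM hunif (divr_gt0 eps0 (ltr0n _ 16)).
(* Averages of K k vertices are used: as the squared radius is r^2 k, the
   Maurey error only depends on K. *)
pose K := (Num.truncn (16 * (D * (r * `|C|) ^+ 2) / eps)).+1.
have K0 : 0 < K%:R :> R by rewrite ltr0n.
have hK : D * ((r * `|C|) ^+ 2 / K%:R) <= eps / 16.
  rewrite mulrA ler_pdivrMr//.
  have : 16 * (D * (r * `|C|) ^+ 2) / eps < K%:R by exact: truncnS_gt.
  by rewrite ltr_pdivrMr//; lra.
pose c := tau ^+ 2 / (32 * M ^+ 2).
have c0 : 0 < c.
  by rewrite divr_gt0 ?mulr_gt0 ?exprn_gt0//; exact: lt_le_trans tauM.
pose u n : R :=
  2 * ((array_dim alpha n * 2 + 1) ^ (K * k n))%:R * expR (- (n%:R * c)).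
have alpha0 : 0 <= alpha by lra.
have ucvg : (u n)%:E @[n --> \oo] --> 0%E.
  by apply: cvg_EFin; [exact: nearW|exact: deviation_bound_cvg0 alpha0 c0 hk].
apply: (@squeeze_cvge _ _ _ _ (fun=> 0%E) _ _ _ _ _ ucvg); last exact: cvg_cst.
near=> n; have n0 : (0 < n)%N by near: n; exact: nbhs_infty_gt.
apply/andP; split; first by apply: ereal_sup_ubound; left.
apply: ge_ereal_sup => _ [->|[F FnF <-]].
  by rewrite lee_fin /u !mulr_ge0// expR_ge0.
have kR : 0 < (k n)%:R :> R by rewrite ltr0n hk0.
pose b0 : R := r * Num.sqrt (k n)%:R.
have b00 : 0 < b0 by rewrite mulr_gt0// sqrtr_gt0.
have hX1 : {ae F, forall z : obs R (array_dim alpha n),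
    forall j, `|tnth z.2 j| <= `|C|}.
  by apply: filterS (hX n F n0 FnF) => z hz j; exact: le_trans (ler_norm C).
have N0 : (0 < K * k n)%N by rewrite muln_gt0 hk0.
have [A [mA PA hA]] := uniform_deviation hlmeas hM hunif n0 N0 (normr_ge0 C)
  b00 tau0 tauM D0 hD hX1.
apply: (@le_trans _ _ (iid_law F n A)); last exact: PA.
rewrite -(@measurable_mu_extE _ _ _ (iid_law F n) A mA).
(* The event need not be measurable, but it is contained in A. *)
apply: le_mu_ext => z /= hz; apply: contrapT => nAz.
move: hz; rewrite !(riskE hlmeas hM hunif) -EFinB lte_fin; apply/negP.
rewrite -leNgt.
have [argbs nnzbs n2bs] := bsP n F n0 FnF.
have [bt1 btmin] := hbtilde n z n0.
have bs1 : norm1 (bs n F) <= b0 by apply: norm1_le => //; exact: hk0.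
have bterr : D * ((b0 * `|C|) ^+ 2 / (K * k n)%:R) <= eps / 16.
  rewrite (_ : (b0 * `|C|) ^+ 2 / (K * k n)%:R = (r * `|C|) ^+ 2 / K%:R)//.
  rewrite /b0 !exprMn sqr_sqrtr ?(ltW kR)// natrM; field.
  by rewrite !gt_eqF.
have := hA z nAz _ bt1; have := hA z nAz _ bs1; have := btmin _ bs1.
rewrite !ler_norml /tau => h1 /andP[h2 h3] /andP[h4 h5].
lra.
Unshelve. all: by end_near. Qed.
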